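(* Let $(X,\mathcal{M},\mu)$ be a measure space with $\mu(X)<\infty$, and $\Phi$ an $N^*$-function for which there is a constant $k\ge2$ with $\Phi(kx)=2\Phi(x)$ for all $x>0$. If $\Lambda=\emptyset$, every continuous linear functional on $(L_\Phi(X),\|\cdot\|_\Phi)$ is identically zero. If $\Lambda\ne\emptyset$, let $\{A_i\}$ be a finite or countable family of pairwise disjoint atoms such that every atom coincides up to a $\mu$-null set with exactly one $A_i$, put $a_i=\mu(A_i)$, and for measurable $f$ let $\overline f_i$ be the a.e. constant value of $f$ on $A_i$. Then every continuous linear functional $U$ on $L_\Phi(X)$ has the form $U(f)=\sum_i u_i\overline f_i$ (with $u_i=U(\chi_{A_i})$), and $\|U\|=\sup_i|u_i|\,\Phi^{-1}(1/a_i)$. Conversely, if real numbers $u_i$ satisfy $|u_i|\le K/\Phi^{-1}(1/a_i)$ for all $i$, for some constant $K$, then $f\mapsto\sum_iu_i\overline f_i$ is a continuous linear functional on $L_\Phi(X)$.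
   Context: An $N^*$-function is a function $\Phi:\mathbb{R}\to\mathbb{R}$ of the form $\Phi(x)=\int_0^{|x|}p(t)\,dt<+\infty$ for all $x$, where $p:[0,\infty)\to[0,\infty]$ is right-continuous, positive on $(0,\infty)$, non-increasing, and satisfies $\lim_{t\to0^+}p(t)=+\infty$ and $\lim_{t\to+\infty}p(t)=0$. $\Phi^{-1}$ is the inverse of $\Phi|_{[0,\infty)}$. $L_\Phi(X)$ is the space of (classes modulo a.e. equality of) measurable $f$ with $\int_X\Phi(f)\,d\mu<\infty$, with quasi-norm $\|f\|_\Phi=\inf\{\lambda>0:\int_X\Phi(|f|/\lambda)\,d\mu\le1\}$; for a linear functional $U$, $\|U\|=\sup\{|U(f)|:\|f\|_\Phi\le1\}$. An atom is a set $A\in\mathcal{M}$ with $\mu(A)>0$ such that every measurable $B\subset A$ with $\mu(B)<\mu(A)$ has $\mu(B)=0$; $\Lambda$ denotes the collection of atoms. *)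

(* Defs.v *)
From HB Require Import structures.
From mathcomp Require Import all_boot all_order all_algebra.
From mathcomp Require Import all_classical all_reals all_analysis.
Set Implicit Arguments. Unset Strict Implicit. Unset Printing Implicit Defensive.
Import Order.TTheory GRing.Theory Num.Theory.
Import numFieldNormedType.Exports.
Local Open Scope classical_set_scope.
Local Open Scope ring_scope.

Section Defs.
Context (R : realType).

Definition NstarFun (Phi : R -> R) : Prop :=
  exists p : R -> \bar R,
    (forall t, 0 <= t -> (0 <= p t)%E) /\
    (forall t, 0 <= t -> p x @[x --> t^'+] --> p t) /\
    (forall t, 0 < t -> (0 < p t)%E) /\
    (forall s t, 0 <= s -> s <= t -> (p t <= p s)%E) /\
    (p x @[x --> 0^'+] --> +oo%E) /\
    (p x @[x --> +oo] --> 0%E) /\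
    (forall x : R, (\int[lebesgue_measure]_(t in `[0%R, `|x|%R]) p t)%E = (Phi x)%:E).

Definition Phi_inv (Phi : R -> R) (y : R) : R :=
  xget 0 [set x | 0 <= x /\ Phi x = y].

Context d (T : measurableType d) (mu : {measure set T -> \bar R}).

(* Orlicz class L_Phi(X) (functions; classes are handled via a.e.-invariance) *)
Definition LPhi (Phi : R -> R) : set (T -> R) :=
  [set f | measurable_fun setT f /\ (\int[mu]_x (Phi (f x))%:E < +oo)%E].

Definition PhiNorm (Phi : R -> R) (f : T -> R) : R :=
  inf [set l : R | 0 < l /\ (\int[mu]_x (Phi (`|f x| / l))%:E <= 1)%E].

(* continuous linear functional on (L_Phi(X), ||.||_Phi); being defined on
   classes modulo a.e. equality means U is invariant under a.e. equality *)
Definition is_clf (Phi : R -> R) (U : (T -> R) -> R) : Prop :=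
  [/\ (forall f g, LPhi Phi f -> LPhi Phi g -> U (f \+ g) = U f + U g),
      (forall (c : R) f, LPhi Phi f -> U (fun x => c * f x) = c * U f),
      (forall f g, LPhi Phi f -> LPhi Phi g ->
          {ae mu, forall x, f x = g x} -> U f = U g) &
      (forall f, LPhi Phi f -> forall e : R, 0 < e -> exists2 del : R, 0 < del &
          forall g, LPhi Phi g -> PhiNorm Phi (g \- f) < del ->
            `|U g - U f| < e)].

Definition opnorm (Phi : R -> R) (U : (T -> R) -> R) : \bar R :=
  ereal_sup [set (`|U f|)%:E | f in [set f | LPhi Phi f /\ PhiNorm Phi f <= 1]].

Definition atom (A : set T) : Prop :=
  [/\ measurable A, (0 < mu A)%E &
      forall B, measurable B -> B `<=` A -> (mu B < mu A)%E -> mu B = 0].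

Definition symdiff (A B : set T) : set T := (A `\` B) `|` (B `\` A).

Definition aeval (A : set T) (f : T -> R) : R :=
  xget 0 [set c | mu (A `&` [set x | f x != c]) = 0].

Definition atom_psum (J : set nat) (A : nat -> set T) (u : nat -> R)
    (f : T -> R) (n : nat) : R :=
  \sum_(0 <= i < n | i \in J) u i * aeval (A i) f.

End Defs.

(* Main.v *)
(* Write I(f) for the integral of Phi(f).  The doubling condition gives
   I(k f) = 2 I(f), and k > 2 because p is unbounded near 0, so a continuous
   functional U is bounded on each set {I <= M}.  Off the atoms, the measure
   E |-> I(f 1_E) is nonatomic, hence f splits into two pieces of half its
   modular; multiplying the better piece by k restores the modular while |U|
   grows by the factor k / 2 > 1, which forces U f = 0.  Thus U only sees the
   atoms, and U f is the sum of the u_i f_i since the modular of the tail of f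
   tends to 0.  For the norm, concavity of Phi gives, when I(f) <= 1,
   |f_i| <= t_i Phi^-1(1/a_i) with t_i = a_i Phi(f_i), and the t_i sum to at
   most 1. *)
Require Import Defs.
From HB Require Import structures.
From mathcomp Require Import all_boot all_order all_algebra.
From mathcomp Require Import all_classical all_reals all_analysis.
From mathcomp Require Import measurable_realfun lra ring.
Import Order.TTheory GRing.Theory Num.Theory.
Import numFieldNormedType.Exports.
Set Implicit Arguments. Unset Strict Implicit. Unset Printing Implicit Defensive.
Local Open Scope classical_set_scope.
Local Open Scope ring_scope.

(** [PhiNorm] is awkward to estimate, whereas the modular is additive over disjoint sets and doubles
    exactly under scaling by [theta]. Estimates are therefore moved to the modular: powers of
    [theta] link [theta ^- n] for [PhiNorm] with [2 ^- n] for the modular, and any other scalar is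
    dominated by such a power. Strictness in [2 < theta] is decisive: with factor 2, as for the
    absolute value and L^1, halving and rescaling would gain nothing. Splitting a modular into equal
    parts requires sets of every intermediate mass, that is Sierpinski's theorem. It is proved for a
    bare real set function, so that it applies to [fine] of the integral of [Phi (f x)], which
    inherits nonatomicity from [mu] because [Phi] vanishes only at 0. *)

(** * From the integral representation of [Phi] to growth and doubling *)

Section primitive_of_nonincreasing.
Context (R : realType) (p : R -> \bar R) (Phi : R -> R).
Hypothesis p_ge0 : forall t, 0 <= t -> (0 <= p t)%E.
Hypothesis p_mono : forall s t, 0 <= s -> s <= t -> (p t <= p s)%E.
Hypothesis PhiE : forall x : R,
  (\int[lebesgue_measure]_(t in `[0%R, `|x|%R]) p t)%E = (Phi x)%:E.

(** By monotonicity the superlevel sets of [p] on the half line are intervals. *)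
Lemma measurable_nonincreasing_ge0 (D : set R) :
  measurable D -> D `<=` `[0, +oo[ -> measurable_fun D p.
Proof.
move=> mD D0; have H : measurable_fun (`[0, +oo[%classic : set R) p; last by apply: measurable_funS H.
move=> _; apply: (measurability _ (ErealGenCInfty.measurableE R)) => //.
move=> _ [_ [a ->] <-]; apply: is_interval_measurable => s t/=.
rewrite !in_itv/= !andbT => -[s0 ps] [t0 pt] u /andP[su ut].
rewrite !in_itv/= !andbT; split; first exact: le_trans su.
exact: le_trans pt (p_mono (le_trans s0 su) ut).
Qed.

Lemma primitive_even (x : R) : Phi `|x| = Phi x.
Proof. by apply/EFin_inj; rewrite -!PhiE normr_id. Qed.

Lemma primitive0 : Phi 0 = 0.
Proof. by apply/EFin_inj; rewrite -PhiE normr0 set_itv1 integral_set1. Qed.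

Lemma primitive_split (x y : R) : 0 <= x -> x <= y ->
  ((Phi y)%:E = (Phi x)%:E + \int[lebesgue_measure]_(t in `]x, y]) p t)%E.
Proof.
move=> x0 xy; rewrite -!PhiE !ger0_norm ?(le_trans x0)//.
have E : `[0, y]%classic = `[0, x] `|` `]x, y].
  by rewrite -(@itv_bndbnd_setU _ _ _ (BRight x))// bnd_simp.
rewrite E ge0_integral_setU//.
- rewrite -E; apply: measurable_nonincreasing_ge0 => // t /=.
  by rewrite !in_itv/= andbT => /andP[].
- by move=> t; rewrite -E/= in_itv/= => /andP[+ _]; exact: p_ge0.
- apply/disj_setPS => t/= []; rewrite !in_itv/= => /andP[_ tx] /andP[xt _].
  by move: (lt_le_trans xt tx); rewrite ltxx.
Qed.

(** On []x, y]] the density is at least [p y]. The bound is a separate real [c] because [p y] is not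
    yet known to be finite; that fact is itself deduced from this inequality. *)
Lemma primitive_increment_ge (x y c : R) : 0 <= x -> x <= y -> 0 <= c ->
  (c%:E <= p y)%E -> Phi x + c * (y - x) <= Phi y.
Proof.
move=> x0 xy c0 cp; rewrite -lee_fin (primitive_split x0 xy) EFinD leeD2l//.
rewrite EFinM -[(y - x)%:E](_ : lebesgue_measure `]x, y] = _); last first.
  by rewrite lebesgue_measure_itv/= lte_fin; case: ltgtP xy => // -> _; rewrite subrr.
rewrite -integral_cst//=; apply: ge0_le_integral => //.
- apply: measurable_nonincreasing_ge0 => // t /=.
  by rewrite !in_itv/= andbT => /andP[xt _]; rewrite (le_trans x0) ?ltW.
- move=> t/=; rewrite in_itv/= => /andP[xt ty]; apply: le_trans cp _.
  by apply: p_mono => //; exact: le_trans (ltW xt).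
Qed.

Lemma primitive_increment_le (x y c : R) : 0 <= x -> x <= y ->
  (p x <= c%:E)%E -> Phi y <= Phi x + c * (y - x).
Proof.
move=> x0 xy pc; rewrite -lee_fin (primitive_split x0 xy) EFinD leeD2l//.
rewrite EFinM -[(y - x)%:E](_ : lebesgue_measure `]x, y] = _); last first.
  by rewrite lebesgue_measure_itv/= lte_fin; case: ltgtP xy => // -> _; rewrite subrr.
have D0 (t : R) : `]x, y]%classic t -> 0 <= t.
  by rewrite /= in_itv/= => /andP[xt _]; rewrite (le_trans x0) ?ltW.
rewrite -integral_cst//=; apply: ge0_le_integral => //.
- by move=> t /D0; exact: p_ge0.
- by apply: measurable_nonincreasing_ge0 => // t /D0/=; rewrite in_itv/= andbT.
- move=> t/=; rewrite in_itv/= => /andP[xt ty]; apply: le_trans pc.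
  by apply: p_mono => //; exact: ltW.
Qed.

(** An infinite value at [x] would give [c * x <= Phi x] for every [c >= 0], which fails for
    [c = (Phi x + 1) / x]. *)
Lemma density_fin_num (x : R) : 0 < x -> p x \is a fin_num.
Proof.
move=> x0; have := p_ge0 (ltW x0).
have bnd (c : R) : 0 <= c -> (c%:E <= p x)%E -> c * x <= Phi x.
  move=> c0 cp; have := primitive_increment_ge (lexx 0) (ltW x0) c0 cp.
  by rewrite primitive0 subr0 add0r.
case: (p x) bnd => [r| |] // bnd _; exfalso.
have Phi0 : 0 <= Phi x by have := bnd 0 (lexx _) (leey _); rewrite mul0r.
have := bnd ((Phi x + 1) / x).
by rewrite divfK ?gt_eqF// leey divr_ge0 ?(ltW x0)// ?addr_ge0//; lra.
Qed.

End primitive_of_nonincreasing.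

(* What the proof needs of [Phi]: on the half line it is increasing and
   star-shaped from above, the latter standing in for concavity; [theta] is the
   factor k of the paper. *)
Record concave_doubling (R : realType) (Phi : R -> R) (theta : R) : Prop := {
  cd_zero : Phi 0 = 0 ;
  cd_even : forall x, Phi `|x| = Phi x ;
  cd_incr : forall x y, 0 <= x -> x < y -> Phi x < Phi y ;
  cd_star : forall s x, 0 <= s -> s <= 1 -> 0 <= x -> s * Phi x <= Phi (s * x) ;
  cd_theta : 2 < theta ;
  cd_double : forall x, Phi (theta * x) = 2 * Phi x }.

Lemma NstarFun_concave_doubling (R : realType) (Phi : R -> R) (k : R) :
  NstarFun Phi -> 2 <= k -> (forall x, 0 < x -> Phi (k * x) = 2 * Phi x) ->
  concave_doubling Phi k.
Proof.
move=> [p [p0 [_ [pgt0 [pm [pinfty [_ pE]]]]]]] k2 Phik.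
have Phi0 := primitive0 pE; have Phie := primitive_even pE.
have pfin x : 0 < x -> p x = (fine (p x))%:E.
  by move=> x0; rewrite fineK// (density_fin_num p0 pm pE).
have p0f x : 0 < x -> 0 < fine (p x) by move=> x0; rewrite -lte_fin -pfin// pgt0.
have below x : 0 < x -> fine (p x) * x <= Phi x.
  move=> x0; have := primitive_increment_ge p0 pm pE (lexx 0) (ltW x0) (ltW (p0f x x0)).
  by rewrite -pfin// lexx => /(_ isT); rewrite Phi0 subr0 add0r.
have double x : Phi (k * x) = 2 * Phi x.
  have [x0|x0|<-] := ltgtP 0 x; [exact: Phik| |by rewrite mulr0 Phi0 mulr0].
  by rewrite -Phie -[Phi x]Phie normrM ger0_norm ?Phik ?normr_gt0 ?lt_eqF//; lra.
split=> //.
- move=> x y x0 xy; have y0 := le_lt_trans x0 xy.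
  have := primitive_increment_ge p0 pm pE x0 (ltW xy) (ltW (p0f y y0)).
  rewrite -pfin// lexx => /(_ isT); apply: lt_le_trans.
  by rewrite ltrDl mulr_gt0 ?p0f ?subr_gt0.
- move=> s x s0 s1 x0.
  move: x0; rewrite le_eqVlt => /predU1P[<-|x0]; first by rewrite mulr0 Phi0 mulr0.
  move: s0; rewrite le_eqVlt => /predU1P[<-|s0]; first by rewrite !mul0r Phi0.
  have sx0 : 0 < s * x by rewrite mulr_gt0.
  have sx : s * x <= x by rewrite ger_pMl.
  (* The slope [P] of [Phi] at [s * x] is compared on both sides: beyond [s * x] the growth is at
     most [P] per unit, and before it at least [P], so [P * (s * x) <= Phi (s * x)]. Eliminating [P]
     gives the claim. *)
  have := primitive_increment_le p0 pm pE (ltW sx0) sx (c := fine (p (s * x))).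
  rewrite -pfin// lexx => /(_ isT) ub.
  have lb := below _ sx0; set P := fine _ in ub lb.
  have : s * Phi x <= s * Phi (s * x) + (1 - s) * (P * (s * x)).
    by rewrite -[X in _ <= X](_ : s * (Phi (s * x) + P * (x - s * x)) = _); [rewrite ler_pM2l|ring].
  by move: lb; have := subr_ge0 s 1; rewrite s1; nra.
(* For [k = 2] the quotient of [Phi (2^-n)] by [2^-n] would be constantly [Phi 1], yet it dominates
   [p (2^-n)], which is unbounded. *)
- rewrite lt_neqAle k2 andbT; apply/eqP => k2E.
  have Phi2 n : Phi (2^-n) = 2^-n * Phi 1.
    elim: n => [|n IH]; first by rewrite expr0 invr1 mul1r.
    have := double (2^-n.+1); rewrite -k2E exprS invfM mulVKf ?pnatr_eq0// IH; lra.
  have [d /= d0 dP] : \forall x \near 0^'+, ((Phi 1 + 1)%:E <= p x)%E.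
    by move/cvgeyPge : pinfty; exact.
  have [n nd] : exists n, (2^-n : R) < d.
    have [n _ /(_ n (leqnn n))/= nd] := near_infty_natSinv_expn_lt (PosNum d0).
    by exists n; rewrite -div1r.
  have n0 : (0 : R) < 2^-n by rewrite invr_gt0 exprn_gt0.
  have := dP (2^-n); rewrite /ball/= sub0r normrN gtr0_norm// => /(_ nd n0).
  rewrite pfin// lee_fin => h; have := below _ n0; rewrite Phi2 mulrC.
  by rewrite ler_pM2l// => /(le_trans h); lra.
Qed.

(** * Intermediate values of a nonatomic set function *)

Section nonatomic_range.
Context (R : realType) (d : measure_display) (T : measurableType d).
Context (m : set T -> R) (E : set T).
Hypothesis mE : measurable E.
Hypothesis m_ge0 : forall A, 0 <= m A.
Hypothesis m_setD : forall A B, measurable A -> measurable B ->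
  A `<=` B -> B `<=` E -> m (B `\` A) = m B - m A.
Hypothesis m_bigcup : forall (F : nat -> set T) (t : R),
  (forall n, measurable (F n)) -> (forall n, F n `<=` E) ->
  nondecreasing_seq F -> (forall n, m (F n) <= t) -> m (\bigcup_n F n) <= t.
Hypothesis m_nonatomic : forall B, measurable B -> B `<=` E -> 0 < m B ->
  exists C, [/\ measurable C, C `<=` B, 0 < m C & m C < m B].

Let m_le A B : measurable A -> measurable B -> A `<=` B -> B `<=` E ->
  m A <= m B.
Proof. by move=> mA mB AB BE; rewrite -subr_ge0 -m_setD. Qed.

(** Splitting a set into two parts of positive mass and keeping the lighter one at least halves the
    mass; iterating reaches any [e]. *)
Lemma nonatomic_small (e : R) (B : set T) : 0 < e ->
  measurable B -> B `<=` E -> 0 < m B ->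
  exists C, [/\ measurable C, C `<=` B, 0 < m C & m C <= e].
Proof.
move=> e0 mB BE B0.
have halve n : exists C, [/\ measurable C, C `<=` B, 0 < m C & m C <= 2^-n * m B].
  elim: n => [|n [C [mC CB C0 Cn]]]; first by exists B; split => //; rewrite expr0 invr1 mul1r.
  have CE := subset_trans CB BE.
  have [D [mD DC D0 DltC]] := m_nonatomic mC CE C0.
  have CD := m_setD mD mC DC CE.
  have h2 : 2^-n.+1 * m B = 2^-n * m B / 2.
    by rewrite exprS invfM; ring.
  have [DC2|DC2] := leP (m D) (m C / 2).
    by exists D; split => //; [exact: subset_trans CB|lra].
  exists (C `\` D); split => //; [exact: measurableD|exact: subset_trans CB|lra|lra].
have [n _ /(_ n (leqnn n))/= hn] := near_infty_natSinv_expn_lt (PosNum (divr_gt0 e0 B0)).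
have [C [mC CB C0 Cn]] := halve n; exists C; split => //.
apply: le_trans Cn _; rewrite div1r in hn.
by rewrite -ler_pdivlMr// ltW.
Qed.

Let admissible (t : R) (B : set T) := [/\ measurable B, B `<=` E & m B <= t].

(** [B'] adds to [B] a piece of more than half the supremum of the masses that still fit below [t],
    or nothing if that supremum is 0. Hence no fitting piece exceeds twice the gain. *)
Let greedy_step (t : R) (B : set T) : admissible t B ->
  exists B', [/\ admissible t B', B `<=` B' &
    forall C, measurable C -> C `<=` E `\` B -> m C <= t - m B ->
      m C <= 2 * (m B' - m B)].
Proof.
move=> [mB BE Bt].
pose S := [set m C | C in
  [set C | [/\ measurable C, C `<=` E `\` B & m C <= t - m B]]].
have m0 : m set0 = 0 by rewrite -(setDv E) m_setD// subrr.
have S0 : S 0 by exists set0 => //; split; rewrite ?m0 ?subr_ge0.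
have hS : has_sup S.
  split; first by exists 0.
  by exists (t - m B) => _ [C [_ _ ?] <-].
have supub C : measurable C -> C `<=` E `\` B -> m C <= t - m B -> m C <= sup S.
  by move=> mC CE Ct; apply: ub_le_sup; [exact: hS.2|exists C].
have [s0|s0] := leP (sup S) 0.
  exists B; split => // C mC CE Ct.
  by rewrite subrr mulr0 (le_trans _ s0)// supub.
have /(sup_adherent) : 0 < sup S / 2 by lra.
move=> /(_ S hS)[_ [C [mC CE Ct] <-] hC].
have mBC : m (B `|` C) = m B + m C.
  have BCE : B `|` C `<=` E by move=> x [/BE//|/CE[]].
  have := m_setD mB (measurableU _ _ mB mC) (@subsetUl _ _ _) BCE.
  rewrite setDUl setDv set0U (_ : C `\` B = C); first by lra.
  by apply/seteqP; split => x; [case|move=> Cx; split => //; case: (CE _ Cx)].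
exists (B `|` C); split; [|exact: subsetUl|].
  split; [exact: measurableU|by move=> x [/BE//|/CE[]]|by rewrite mBC; lra].
by move=> D mD DE Dt; have := supub _ mD DE Dt; rewrite mBC; lra.
Qed.

(* Sierpinski's theorem, by exhausting [E] greedily below the level [t]. *)
Lemma nonatomic_attains (t : R) : 0 <= t -> t <= m E ->
  exists D, [/\ measurable D, D `<=` E & m D = t].
Proof.
move=> t0 tE.
have m0 : m set0 = 0 by rewrite -(setDv E) m_setD// subrr.
have /choice[f fP] : forall B, exists B', admissible t B ->
    [/\ admissible t B', B `<=` B' & forall C, measurable C ->
      C `<=` E `\` B -> m C <= t - m B -> m C <= 2 * (m B' - m B)].
  move=> B; have [/greedy_step[B' ?]|nB] := pselect (admissible t B).
    by exists B'.
  by exists B => /nB.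
pose F n := iter n f set0.
have F0 : admissible t (F 0%N) by split; rewrite /F/= ?m0 //; exact: sub0set.
have Fadm n : admissible t (F n).
  by elim: n => [|n /fP[]].
have FS n : F n `<=` F n.+1 by have [] := fP _ (Fadm n).
have Fnd : nondecreasing_seq F by apply/nondecreasing_seqP => n; apply/subsetPset.
have mF n : measurable (F n) by have [] := Fadm n.
have FE n : F n `<=` E by have [] := Fadm n.
pose D := \bigcup_n F n.
have mD : measurable D by exact: bigcup_measurable.
have DE : D `<=` E by move=> x [n _ /FE].
have Dt : m D <= t by apply: m_bigcup => // n; have [] := Fadm n.
exists D; split => //; apply/eqP; rewrite eq_le Dt leNgt; apply/negP => ltDt.
have [||C [mC CED C0 Ct]] :=
    @nonatomic_small (t - m D) (E `\` D) _ (measurableD mE mD) (@subDsetl _ _ _).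
- by rewrite subr_gt0.
- by rewrite m_setD// subr_gt0 (lt_le_trans ltDt).
(* [C] avoids [D] and fits below [t], so it was a candidate at every stage; every stage then gained
   at least half of [m C], and the masses would outgrow [t]. *)
have step n : m C <= 2 * (m (F n.+1) - m (F n)).
  have [_ _] := fP _ (Fadm n); apply => //.
    by move=> x /CED[Ex nDx]; split => // Fx; apply: nDx; exists n.
  have : m (F n) <= m D by apply: m_le => //; exact: bigcup_sup.
  lra.
have grow n : n%:R * m C <= 2 * m (F n).
  elim: n => [|n IH]; first by rewrite mul0r mulr_ge0.
  by have := step n; rewrite -natr1 mulrDl mul1r; lra.
have := grow (Num.truncn (2 * t / m C)).+1.
have : 2 * t < (Num.truncn (2 * t / m C)).+1%:R * m C.
  by rewrite -ltr_pdivrMr// truncnS_gt.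
have [_ _] := Fadm (Num.truncn (2 * t / m C)).+1; lra.
Qed.

End nonatomic_range.

(** * Subadditivity, inverse and measurability of [Phi] *)

Section concave_doubling_theory.
Context (R : realType) (Phi : R -> R) (theta : R).
Hypothesis PhiP : concave_doubling Phi theta.

Lemma theta_gt0 : 0 < theta. Proof. by have := cd_theta PhiP; lra. Qed.

Lemma Phi_le (x y : R) : `|x| <= `|y| -> Phi x <= Phi y.
Proof.
rewrite -(cd_even PhiP x) -(cd_even PhiP y) le_eqVlt => /predU1P[->//|xy].
by rewrite ltW// (cd_incr PhiP).
Qed.

Lemma Phi_ge0 (x : R) : 0 <= Phi x.
Proof. by rewrite -(cd_zero PhiP) Phi_le// normr0. Qed.

Lemma Phi_gt0 (x : R) : x != 0 -> 0 < Phi x.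
Proof.
move=> x0; rewrite -(cd_zero PhiP) -(cd_even PhiP x).
by rewrite (cd_incr PhiP)// normr_gt0.
Qed.

Lemma Phi_le_inv (x y : R) : 0 <= y -> Phi x <= Phi y -> `|x| <= y.
Proof.
move=> y0; rewrite -(cd_even PhiP x) leNgt => /negP h; rewrite leNgt.
by apply/negP => yx; apply: h; rewrite (cd_incr PhiP).
Qed.

(** Star-shapedness bounds [Phi a] and [Phi b] below by the fractions [a / (a + b)] and
    [b / (a + b)] of [Phi (a + b)], and these fractions add up to 1. *)
Lemma Phi_subadd (x y : R) : Phi (x + y) <= Phi x + Phi y.
Proof.
rewrite -(cd_even PhiP x) -(cd_even PhiP y).
apply: (@le_trans _ _ (Phi (`|x| + `|y|))).
  by apply: Phi_le; rewrite [leRHS]ger0_norm ?addr_ge0// ler_normD.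
move: (normr_ge0 x) (normr_ge0 y); move: `|x| `|y| => a b a0 b0.
have [ab0|ab0] := leP (a + b) 0.
  have -> : a = 0 by lra.
  by rewrite add0r (cd_zero PhiP) add0r.
have star c : 0 <= c -> c <= a + b -> c / (a + b) * Phi (a + b) <= Phi c.
  move=> c0 cab; rewrite -[in X in _ <= X](divfK (lt0r_neq0 ab0) c).
  apply: (cd_star PhiP); rewrite ?divr_ge0 ?(ltW ab0)//.
  by rewrite ler_pdivrMr// mul1r.
have := lerD (star a a0 _) (star b b0 _).
by rewrite -mulrDl -mulrDl divff ?gt_eqF// mul1r => -> //; lra.
Qed.

Lemma Phi_iter (n : nat) (x : R) : Phi (theta ^+ n * x) = 2 ^+ n * Phi x.
Proof.
elim: n => [|n IH]; first by rewrite !expr0 !mul1r.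
by rewrite !exprS -!mulrA (cd_double PhiP) IH.
Qed.

Lemma Phi_iterV (n : nat) (x : R) : Phi (theta ^- n * x) = 2 ^- n * Phi x.
Proof.
have t0 : theta ^+ n != 0 by rewrite expf_neq0// gt_eqF// theta_gt0.
by rewrite -[in RHS](mulVKf t0 x) Phi_iter mulKf// expf_neq0.
Qed.

(** Star-shapedness stands in for continuity: read at [s^-1] it says [Phi (s * x) <= s * Phi x] for
    [1 <= s], which excludes jumps. Doubling makes [Phi] arbitrarily small and large along powers of
    [theta], so the sublevel set of [y] has a positive finite supremum, the preimage sought. *)
Lemma Phi_surjective (y : R) : 0 < y -> exists2 x, 0 < x & Phi x = y.
Proof.
move=> y0; have P1 : 0 < Phi 1 by rewrite Phi_gt0.
have t0 n : 0 < theta ^+ n by rewrite exprn_gt0// theta_gt0.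
have small (e : R) : 0 < e -> exists n, 2 ^- n < e.
  move=> e0; have [n _ /(_ n (leqnn n))/= h] := near_infty_natSinv_expn_lt (PosNum e0).
  by exists n; rewrite -div1r.
have [a a0 ay] : exists2 a, 0 < a & Phi a <= y.
  have [n hn] := small _ (divr_gt0 y0 P1).
  exists (theta ^- n); first by rewrite invr_gt0.
  by rewrite -[_ ^- _]mulr1 Phi_iterV -ler_pdivlMr// ltW.
have [b b0 yb] : exists2 b, 0 < b & y < Phi b.
  have [n hn] := small _ (divr_gt0 P1 y0).
  exists (theta ^+ n) => //; rewrite -[_ ^+ _]mulr1 Phi_iter.
  by rewrite -ltr_pdivrMl ?exprn_gt0//; move: hn; rewrite ltr_pdivlMr.
pose S := [set x | 0 <= x /\ Phi x <= y].
have hS : has_sup S.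
  split; first by exists a; split => //; exact: ltW.
  exists b => x [x0 xy]; rewrite leNgt; apply/negP => bx.
  by have := cd_incr PhiP (ltW b0) bx; lra.
have s0 : 0 < sup S.
  by apply: (lt_le_trans a0); apply: ub_le_sup; [exact: hS.2|split => //; exact: ltW].
have scale s x : 1 <= s -> 0 <= x -> Phi (s * x) <= s * Phi x.
  move=> s1 x0; have s0' : 0 < s by lra.
  have sV : s^-1 <= 1 by rewrite invf_le1.
  have sV0 : 0 <= s^-1 by rewrite invr_ge0 ltW.
  have := cd_star PhiP sV0 sV (mulr_ge0 (ltW s0') x0).
  by rewrite mulKf ?gt_eqF// ler_pdivrMl.
exists (sup S) => //; apply/eqP; rewrite eq_le; apply/andP; split; rewrite leNgt; apply/negP => h.
(* If [Phi] overshoots [y] by a factor [q], then [Phi] is still at least [y] at [q^-1 * sup S],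
   although a larger point lies in [S]. *)
- have q1 : 1 < Phi (sup S) / y by rewrite ltr_pdivlMr// mul1r.
  set q := Phi (sup S) / y in q1; have q0 : 0 < q by lra.
  have qy : q * y = Phi (sup S) by rewrite divfK// gt_eqF.
  have qx : q * (q^-1 * sup S) = sup S by rewrite mulVKf// gt_eqF.
  have x0 : 0 < q^-1 * sup S by rewrite mulr_gt0// invr_gt0.
  have xS : q^-1 * sup S < sup S by rewrite gtr_pMl// invf_lt1.
  have [z [z0 zy] xz] : exists2 z, S z & q^-1 * sup S < z.
    have /(sup_adherent)/(_ hS)[z Sz] : 0 < sup S - q^-1 * sup S by rewrite subr_gt0.
    by rewrite opprB addrC subrK; exists z.
  have Px := lt_le_trans (cd_incr PhiP (ltW x0) xz) zy.
  have := scale _ _ (ltW q1) (ltW x0); rewrite qx.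
  by move: Px; rewrite -(ltr_pM2l q0); lra.
(* If [Phi] falls short of [y], stretching [sup S] by the missing factor stays in [S] and exceeds
   its supremum. *)
- have P0 : 0 < Phi (sup S) by rewrite Phi_gt0// gt_eqF.
  have q1 : 1 < y / Phi (sup S) by rewrite ltr_pdivlMr// mul1r.
  have q0 : 0 < y / Phi (sup S) by lra.
  have : y / Phi (sup S) * sup S <= sup S.
    apply: ub_le_sup; first exact: hS.2.
    split; first by rewrite mulr_ge0// ltW.
    by have := scale _ _ (ltW q1) (ltW s0); rewrite divfK// gt_eqF.
  by rewrite ger_pMl//; lra.
Qed.

Lemma Phi_inv_gt0 (y : R) : 0 < y -> 0 < Phi_inv Phi y.
Proof.
move=> y0; rewrite /Phi_inv; case: xgetP => [x _ [x0 xy]|/(_ _)h].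
  rewrite lt_neqAle x0 andbT; apply/eqP => x00.
  by move: xy y0; rewrite -x00 (cd_zero PhiP) => ->; rewrite ltxx.
have [x x0 xy] := Phi_surjective y0; case: (h x); split => //; exact: ltW.
Qed.

Lemma Phi_invK (y : R) : 0 < y -> Phi (Phi_inv Phi y) = y.
Proof.
move=> y0; rewrite /Phi_inv; case: xgetP => [x _ []//|h].
have [x x0 xy] := Phi_surjective y0; case: (h x); split => //; exact: ltW.
Qed.

(** [Phi] is even, so it is the norm followed by a function that is constant on the negative axis
    and monotone on the whole line. *)
Lemma measurable_Phi : measurable_fun [set: R] Phi.
Proof.
have -> : Phi = (fun x => Phi (Num.max 0 x)) \o Num.norm.
  by apply/funext => x /=; rewrite max_r// (cd_even PhiP).
apply: measurableT_comp => //; apply: nondecreasing_measurable => // x y xy.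
have max0 z : 0 <= Num.max 0 z :> R by rewrite le_max lexx.
by apply: Phi_le; rewrite !ger0_norm// ge_max max0 le_max xy orbT.
Qed.

End concave_doubling_theory.

(** * The modular, the space [LPhi] and the quasi-norm *)

Section modular.
Context (R : realType) (Phi : R -> R) (theta : R).
Hypothesis PhiP : concave_doubling Phi theta.
Context (d : measure_display) (T : measurableType d).
Context (mu : {measure set T -> \bar R}).
Implicit Types f g : T -> R.

Definition modular (f : T -> R) : \bar R := (\int[mu]_x (Phi (f x))%:E)%E.

Lemma measurable_Phi_comp (D : set T) (f : T -> R) :
  measurable_fun setT f -> measurable_fun D (fun x => (Phi (f x))%:E).
Proof.
move=> mf; apply/measurable_EFinP; apply: measurable_funTS.
exact: (measurableT_comp (measurable_Phi PhiP)).
Qed.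

Lemma modular_ge0 f : (0 <= modular f)%E.
Proof. by apply: integral_ge0 => x _; rewrite lee_fin (Phi_ge0 PhiP). Qed.

Lemma modular_fin_num f : LPhi mu Phi f -> modular f \is a fin_num.
Proof. by case=> _ hf; rewrite ge0_fin_numE// modular_ge0. Qed.

Lemma modular_le f g : measurable_fun setT f -> measurable_fun setT g ->
  (forall x, `|f x| <= `|g x|) -> (modular f <= modular g)%E.
Proof.
move=> mf mg fg; apply: ge0_le_integral => //.
- by move=> x _; rewrite lee_fin (Phi_ge0 PhiP).
- exact: measurable_Phi_comp.
- exact: measurable_Phi_comp.
- by move=> x _; rewrite lee_fin (Phi_le PhiP).
Qed.

Lemma modular0 : modular (cst 0) = 0%E.
Proof.
by rewrite /modular; under eq_integral do rewrite /= (cd_zero PhiP); exact: integral0.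
Qed.

Lemma modularX f (n : nat) : measurable_fun setT f ->
  modular (fun x => theta ^+ n * f x) = ((2 ^+ n)%:E * modular f)%E.
Proof.
move=> mf; rewrite /modular -ge0_integralZl//.
- by apply: eq_integral => x _; rewrite (Phi_iter PhiP) EFinM.
- exact: measurable_Phi_comp.
- by move=> x _; rewrite lee_fin (Phi_ge0 PhiP).
Qed.

Lemma modularXV f (n : nat) : measurable_fun setT f ->
  modular (fun x => theta ^- n * f x) = ((2 ^- n)%:E * modular f)%E.
Proof.
move=> mf; rewrite /modular -ge0_integralZl//.
- by apply: eq_integral => x _; rewrite (Phi_iterV PhiP) EFinM.
- exact: measurable_Phi_comp.
- by move=> x _; rewrite lee_fin (Phi_ge0 PhiP).
Qed.

Lemma modularD f g : measurable_fun setT f -> measurable_fun setT g ->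
  (modular (f \+ g)%R <= modular f + modular g)%E.
Proof.
move=> mf mg; rewrite /modular -ge0_integralD//; last 4 first.
- by move=> x _; rewrite lee_fin (Phi_ge0 PhiP).
- exact: measurable_Phi_comp.
- by move=> x _; rewrite lee_fin (Phi_ge0 PhiP).
- exact: measurable_Phi_comp.
apply: ge0_le_integral => //.
- by move=> x _; rewrite lee_fin (Phi_ge0 PhiP).
- exact/measurable_Phi_comp/measurable_funD.
- by apply: emeasurable_funD; exact: measurable_Phi_comp.
- by move=> x _; rewrite -EFinD lee_fin (Phi_subadd PhiP).
Qed.

Lemma modular_restrict f (D : set T) : measurable D ->
  modular (fun x => f x * \1_D x) = (\int[mu]_(x in D) (Phi (f x))%:E)%E.
Proof.
move=> mD; rewrite [RHS]integral_mkcond; apply: eq_integral => x _.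
by rewrite patchE indicE; case: ifP => xD; rewrite ?mulr1 ?mulr0 ?(cd_zero PhiP).
Qed.

Lemma LPhi_le f g : LPhi mu Phi f -> measurable_fun setT g ->
  (forall x, `|g x| <= `|f x|) -> LPhi mu Phi g.
Proof.
move=> [mf hf] mg gf; split => //; apply: le_lt_trans hf; exact: modular_le.
Qed.

Lemma LPhi_restrict f (D : set T) : measurable D -> LPhi mu Phi f ->
  LPhi mu Phi (fun x => f x * \1_D x).
Proof.
move=> mD Lf; apply: (LPhi_le Lf).
  by apply: measurable_funM; [case: Lf|exact: measurable_indic].
by move=> x; rewrite normrM indicE; case: (_ \in _); rewrite ?normr1 ?normr0 ?mulr1// mulr0.
Qed.

Lemma LPhiD f g : LPhi mu Phi f -> LPhi mu Phi g -> LPhi mu Phi (f \+ g).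
Proof.
move=> [mf hf] [mg hg]; split; first exact: measurable_funD.
by apply: (le_lt_trans (modularD mf mg)); rewrite lte_add_pinfty.
Qed.

Lemma LPhi0 : LPhi mu Phi (cst 0).
Proof. by split => //; rewrite -/(modular _) modular0. Qed.

Lemma LPhiX f (n : nat) : LPhi mu Phi f -> LPhi mu Phi (fun x => theta ^+ n * f x).
Proof.
move=> [mf hf]; split; first exact: measurable_funM.
rewrite -/(modular _) modularX// lte_mul_pinfty// ?lee_fin ?exprn_ge0//.
Qed.

Lemma theta_expr_unbounded (x : R) : exists n, x <= theta ^+ n.
Proof.
exists (Num.truncn x).+1; apply: le_trans (ltW (truncnS_gt x)) _.
have t2 := cd_theta PhiP.
elim: (_.+1) => [|n IH]; first by rewrite expr0.
have : 1 <= theta ^+ n by rewrite exprn_ege1//; lra.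
by rewrite exprS -natr1; nra.
Qed.

(** Doubling controls only scaling by powers of [theta]; a general scalar is dominated by one of
    them. *)
Lemma LPhiZ f (c : R) : LPhi mu Phi f -> LPhi mu Phi (fun x => c * f x).
Proof.
move=> Lf; have [n cn] := theta_expr_unbounded `|c|.
apply: (LPhi_le (LPhiX n Lf)).
  by case: Lf => mf _; exact: measurable_funM.
move=> x; rewrite !normrM ler_wpM2r// (le_trans cn)// ler_norm//.
Qed.

Lemma LPhiB f g : LPhi mu Phi f -> LPhi mu Phi g -> LPhi mu Phi (f \- g).
Proof.
move=> Lf /(LPhiZ (-1)) Lg.
rewrite (_ : f \- g = f \+ (fun x => -1 * g x)); first exact: LPhiD.
by apply/funext => x /=; rewrite mulN1r.
Qed.

Lemma modular_normdiv f (l : R) :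
  (\int[mu]_x (Phi (`|f x| / l))%:E)%E = modular (fun x => l^-1 * f x).
Proof.
apply: eq_integral => x _; rewrite mulrC -(cd_even PhiP) normrM normr_id -normrM.
by rewrite (cd_even PhiP).
Qed.

(** Dividing by [theta ^- n] multiplies the modular by [2 ^+ n], so [theta ^- n] is admissible in
    the infimum. *)
Lemma PhiNorm_le_modular f (n : nat) : LPhi mu Phi f ->
  (modular f <= (2 ^- n)%:E)%E -> PhiNorm mu Phi f <= theta ^- n.
Proof.
move=> Lf hn; apply: ge_inf; first by exists 0 => l [/ltW].
have t0 := exprn_gt0 n (theta_gt0 PhiP).
split; first by rewrite invr_gt0.
rewrite modular_normdiv invrK modularX; last by case: Lf.
have := @lee_wpmul2l _ (2 ^+ n)%:E _ _ _ hn.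
by rewrite lee_fin exprn_ge0// -EFinM divff ?expf_neq0// => /(_ isT).
Qed.

Lemma PhiNorm_lt_ex f (l : R) : LPhi mu Phi f -> PhiNorm mu Phi f < l ->
  exists l' : R, [/\ 0 < l', l' < l & (modular (fun x => l'^-1 * f x)%R <= 1)%E].
Proof.
move=> Lf; rewrite /PhiNorm; set S := [set _ | _] => hl.
(* The infimum of an empty set would carry no information; [theta ^+ n] is admissible as soon as
   [2 ^+ n] dominates the modular of [f]. *)
have hS : S !=set0.
  have [r rE] : exists r, modular f = r%:E.
    by exists (fine (modular f)); rewrite fineK// modular_fin_num.
  have [n hn] : exists n, r <= 2 ^+ n.
    exists (Num.truncn r).+1; apply: le_trans (ltW (truncnS_gt r)) _.
    by rewrite -natrX ler_nat ltnW// ltn_expl.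
  exists (theta ^+ n); split; first by rewrite exprn_gt0// (theta_gt0 PhiP).
  rewrite modular_normdiv modularXV; last by case: Lf.
  by rewrite rE -EFinM lee_fin ler_pdivrMl ?exprn_gt0// mulr1.
have [l' [l'0 h] l'l] := inf_lt hS hl.
by exists l'; split => //; rewrite -modular_normdiv.
Qed.

End modular.

Lemma measurable_neq_cst (R : realType) (d : measure_display)
    (T : measurableType d) (f : T -> R) (c : R) :
  measurable_fun setT f -> measurable [set x | f x != c].
Proof.
move=> mf; have mC : measurable (~` [set c] : set R) by exact: measurableC.
have := mf measurableT _ mC; rewrite setTI; congr measurable.
by apply/seteqP; split => x /= /eqP.
Qed.

(** * Continuous functionals: boundedness, and vanishing off the atoms *)

Section continuous_functional.
Context (R : realType) (Phi : R -> R) (theta : R).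
Hypothesis PhiP : concave_doubling Phi theta.
Context (d : measure_display) (T : measurableType d).
Context (mu : {measure set T -> \bar R}).
Context (U : (T -> R) -> R).
Hypothesis UP : is_clf mu Phi U.
Implicit Types f g : T -> R.

Lemma clfD f g : LPhi mu Phi f -> LPhi mu Phi g -> U (f \+ g) = U f + U g.
Proof. by case: UP => + _ _ _; exact. Qed.

Lemma clfZ (c : R) f : LPhi mu Phi f -> U (fun x => c * f x) = c * U f.
Proof. by case: UP => _ + _ _; exact. Qed.

Lemma clf0 : U (cst 0) = 0.
Proof.
rewrite -[RHS](mul0r (U (cst 0))) -(clfZ 0 (LPhi0 PhiP mu)).
by congr U; apply/funext => x /=; rewrite mul0r.
Qed.

Lemma clf_small (e : R) : 0 < e -> exists2 del : R, 0 < del &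
  forall g, LPhi mu Phi g -> (modular Phi mu g <= del%:E)%E -> `|U g| < e.
Proof.
move=> e0; case: UP => _ _ _ /(_ _ (LPhi0 PhiP mu) _ e0)[del del0 Udel].
(* The added 1 makes [theta ^- n < del] strict, as continuity at 0 requires. *)
have [n hn] := theta_expr_unbounded PhiP (del^-1 + 1).
exists (2 ^- n); first by rewrite invr_gt0 exprn_gt0.
move=> g Lg gn; have := Udel g Lg; rewrite clf0 subr0; apply.
rewrite (_ : g \- cst 0 = g); last by apply/funext => x /=; rewrite subr0.
apply: (le_lt_trans (PhiNorm_le_modular PhiP Lg gn)).
have di : 0 < del^-1 by rewrite invr_gt0.
by rewrite -[ltRHS]invrK ltf_pV2 ?posrE ?exprn_gt0 ?(theta_gt0 PhiP)//; lra.
Qed.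

(** Scaling by [theta ^- n] divides the modular by [2 ^+ n], which brings the ball of radius [M]
    into one where [U] stays below 1; undoing the scaling costs [theta ^+ n]. *)
Lemma clf_bounded (M : R) : exists C : R,
  forall g, LPhi mu Phi g -> (modular Phi mu g <= M%:E)%E -> `|U g| <= C.
Proof.
have [del del0 Udel] := clf_small ltr01.
have [n hn] : exists n, M / del <= 2 ^+ n.
  exists (Num.truncn (M / del)).+1; apply: le_trans (ltW (truncnS_gt (M / del))) _.
  by rewrite -natrX ler_nat ltnW// ltn_expl.
exists (theta ^+ n) => g Lg gM.
have t0 : 0 < theta ^+ n by rewrite exprn_gt0// (theta_gt0 PhiP).
have Lg' := LPhiZ PhiP (theta ^- n) Lg.
have := Udel _ Lg'; rewrite (modularXV PhiP); last by case: Lg.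
rewrite clfZ// normrM (gtr0_norm (_ : 0 < theta ^- n)) ?invr_gt0// ltr_pdivrMl// mulr1.
move=> h; apply/ltW/h; apply: (@le_trans _ _ ((2 ^- n)%:E * M%:E)%E).
  by rewrite lee_wpmul2l// lee_fin invr_ge0 exprn_ge0.
by rewrite -EFinM lee_fin ler_pdivrMl ?exprn_gt0// -ler_pdivrMr.
Qed.

Section atomless_part.
Context (E : set T).
Hypothesis mE : measurable E.
Hypothesis atomlessE : forall B, B `<=` E -> ~ atom mu B.

(** Sierpinski's theorem at level [m E / 2] for the integral of [Phi (g x)]; the main point is to
    derive its nonatomicity from the absence of [mu]-atoms in [E]. *)
Lemma modular_halving g : LPhi mu Phi g -> exists D, [/\ measurable D, D `<=` E,
  (\int[mu]_(x in D) (Phi (g x))%:E <= 2^-1%:E * modular Phi mu g)%E &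
  (\int[mu]_(x in E `\` D) (Phi (g x))%:E <= 2^-1%:E * modular Phi mu g)%E].
Proof.
move=> Lg; have [mg _] := Lg.
have mPhi D : measurable_fun D (fun x => (Phi (g x))%:E).
  exact: (measurable_Phi_comp PhiP).
have Pg0 x : (0 <= (Phi (g x))%:E)%E by rewrite lee_fin (Phi_ge0 PhiP).
pose nu A := (\int[mu]_(x in A) (Phi (g x))%:E)%E.
have nu_ge0 A : (0 <= nu A)%E by apply: integral_ge0.
have nu_le A B : measurable A -> measurable B -> A `<=` B -> (nu A <= nu B)%E.
  by move=> mA mB AB; apply: ge0_subset_integral.
have nu_fin A : measurable A -> nu A \is a fin_num.
  move=> mA; rewrite ge0_fin_numE//; have [_] := Lg; apply: le_lt_trans.
  exact: nu_le.
have nuD A B : measurable A -> measurable B -> A `<=` B ->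
    nu B = (nu A + nu (B `\` A))%E.
  move=> mA mB AB; rewrite /nu -[in LHS](setDUK AB) ge0_integral_setU//.
    exact: measurableD.
  by apply/disj_setPS => x [Ax []].
pose m A := fine (nu A).
have m_setD A B : measurable A -> measurable B -> A `<=` B -> B `<=` E ->
    m (B `\` A) = m B - m A.
  move=> mA mB AB _; have mBA := measurableD mB mA.
  have : m B = m A + m (B `\` A) by rewrite /m -fineD ?nu_fin// -nuD.
  by move=> ->; rewrite addrC addKr.
have m_ge0 A : 0 <= m A by apply: fine_ge0.
have m_bigcup (F : nat -> set T) (t : R) : (forall n, measurable (F n)) ->
    (forall n, F n `<=` E) -> nondecreasing_seq F -> (forall n, m (F n) <= t) ->
    m (\bigcup_n F n) <= t.
  move=> mF FE Fnd Ft; rewrite -lee_fin fineK ?nu_fin//; last exact: bigcup_measurable.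
  have cv := @ge0_nondecreasing_set_cvg_integral _ _ _ F _ mu Fnd mF (fun n => mPhi (F n)) (fun n x _ => Pg0 x).
  rewrite /nu -(cvg_lim _ cv)//; apply: lime_le; first by apply/cvg_ex; eexists; exact: cv.
  by apply: nearW => n; rewrite -[leLHS]fineK ?lee_fin//; [exact: Ft|exact: nu_fin].
have m_nonatomic B : measurable B -> B `<=` E -> 0 < m B ->
    exists C, [/\ measurable C, C `<=` B, 0 < m C & m C < m B].
  move=> mB BE B0.
  (* Discarding the zeros of [g] leaves [nu] unchanged and makes [nu] and [mu] have the same null
     subsets, so a set showing that [B'] is no [mu]-atom also splits [nu]. *)
  pose B' := B `&` [set x | g x != 0].
  have mB' : measurable B'.
    by apply: measurableI => //; exact: measurable_neq_cst.
  have nu0 C : measurable C -> nu C = 0%E -> C `<=` B' -> mu C = 0%E.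
    move=> mC C0 CB'.
    have /(ae_eq_integral_abs mu mC (mPhi C)) h : (\int[mu]_(x in C) `|(Phi (g x))%:E|)%E = 0%E.
      by rewrite -[RHS]C0; apply: eq_integral => x _; rewrite gee0_abs.
    apply/negligibleP => //; apply: negligibleS h => x Cx /(_ Cx)/= [Pg].
    by have [_ /(Phi_gt0 PhiP)] := CB' _ Cx; rewrite Pg ltxx.
  have B'B : B' `<=` B by exact: subIsetl.
  have nuB' : nu B' = nu B.
    rewrite (nuD B' B)// [X in (_ + X)%E](_ : _ = 0%E) ?adde0//.
    apply: integral0_eq => x [Bx nB'x]; rewrite (_ : g x = 0) ?(cd_zero PhiP)//.
    by apply/eqP/negPn/negP => gx; exact: nB'x.
  have muB' : (0 < mu B')%E.
    rewrite lt0e measure_ge0 andbT; apply/eqP => muB'0.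
    have : (\int[mu]_(x in B') `|(Phi (g x))%:E|)%E = 0%E by exact: integral_abs_eq0.
    under eq_integral do rewrite gee0_abs//.
    by rewrite -/(nu B') nuB' => nuB0; move: B0; rewrite /m nuB0 ltxx.
  have [C [mC CB' CltB' C0]] : exists C, [/\ measurable C, C `<=` B',
      (mu C < mu B')%E & mu C <> 0%E].
    apply: contrapT => noC; apply: (atomlessE (subset_trans B'B BE)); split => //.
    by move=> C mC CB' CltB'; apply: contrapT => C0; apply: noC; exists C.
  have mD := measurableD mB' mC.
  exists C; split => //; first exact: subset_trans CB' B'B.
    rewrite /m fine_gt0// lt0e nu_ge0 andbT -ge0_fin_numE// nu_fin// andbT.
    by apply/eqP => /(nu0 C mC)/(_ CB').
  (* The remainder carries [nu]-mass too: otherwise it would be [mu]-null and [mu C] would equal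
     [mu B']. *)
  rewrite -[X in _ < X]/(fine (nu B)) -nuB' (nuD C B')// fineD ?nu_fin// ltrDl.
  rewrite fine_gt0// lt0e nu_ge0 andbT -ge0_fin_numE// nu_fin// andbT.
  apply/eqP => /(nu0 _ mD)/(_ (@subDsetl _ _ _)) D0.
  have : mu B' = mu C.
    rewrite -[in LHS](setDUK CB') measureU//; last by apply/seteqP; split => // x [Cx []].
    by rewrite -[RHS]adde0; congr (_ + _)%E.
  by move=> B'C; move: CltB'; rewrite B'C ltxx.
have EE : E `<=` E by [].
have hE : m E / 2 <= m E by have := m_ge0 E; lra.
have [D [mD DE Dhalf]] := nonatomic_attains mE m_ge0 m_setD m_bigcup m_nonatomic
  (divr_ge0 (m_ge0 E) (ler0n R 2)) hE.
have mEg : ((m E)%:E <= modular Phi mu g)%E.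
  by rewrite /m fineK ?nu_fin//; apply: nu_le.
have half : ((m E / 2)%:E <= 2^-1%:E * modular Phi mu g)%E.
  by rewrite mulrC EFinM lee_wpmul2l.
exists D; split => //; apply: le_trans half.
- by rewrite -Dhalf /m fineK ?nu_fin.
- have mED := measurableD mE mD.
  rewrite -[leLHS]/(nu (E `\` D)) -[nu _]fineK ?nu_fin// lee_fin -/(m _).
  by rewrite m_setD// Dhalf; lra.
Qed.

(** Vanishing off [E] is carried along because it makes the pieces on the two halves of [E] add up
    to the whole function, now and at the next iteration. *)
Lemma atomless_boost g : LPhi mu Phi g -> (forall x, ~ E x -> g x = 0) ->
  exists g', [/\ LPhi mu Phi g', forall x, ~ E x -> g' x = 0,
    (modular Phi mu g' <= modular Phi mu g)%E & theta / 2 * `|U g| <= `|U g'| ].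
Proof.
move=> Lg gE; have [D [mD DE hD hED]] := modular_halving Lg.
have mED := measurableD mE mD.
have Lr A mA := LPhi_restrict PhiP (D := A) mA Lg.
have gU : U g = U (fun x => g x * \1_D x) + U (fun x => g x * \1_(E `\` D) x).
  rewrite -clfD; [|exact: Lr|exact: Lr].
  congr U; apply/funext => x /=; rewrite !indicE -mulrDr.
  have [/gE->|Ex] := pselect (~ E x); first by rewrite mul0r.
  have {}Ex : E x by apply: contrapT.
  have [Dx|nDx] := pselect (D x).
    by rewrite mem_set// memNset ?addr0 ?mulr1//; case.
  by rewrite memNset// mem_set ?add0r ?mulr1//; split.
have boost A : measurable A -> A `<=` E ->
    (\int[mu]_(x in A) (Phi (g x))%:E <= 2^-1%:E * modular Phi mu g)%E ->
    `|U g| / 2 <= `|U (fun x => g x * \1_A x)| ->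
    exists g', [/\ LPhi mu Phi g', forall x, ~ E x -> g' x = 0,
      (modular Phi mu g' <= modular Phi mu g)%E & theta / 2 * `|U g| <= `|U g'| ].
  move=> mA AE hA UA; have Lg' := Lr A mA.
  exists (fun x => theta ^+ 1 * (g x * \1_A x)); split.
  - exact: (LPhiX PhiP).
  - by move=> x /gE->; rewrite mul0r mulr0.
  - rewrite (modularX PhiP); last by case: Lg'.
    rewrite (modular_restrict PhiP)//; apply: le_trans (_ : (2 * (2^-1%:E * modular Phi mu g) <= _)%E).
      by rewrite lee_wpmul2l.
    by rewrite muleA -EFinM divff// mul1e.
  - rewrite clfZ// normrM expr1 (ger0_norm (ltW (theta_gt0 PhiP))).
    by have := theta_gt0 PhiP; nra.
have [h|h] := leP (`|U g| / 2) `|U (fun x => g x * \1_D x)|; first exact: (boost D).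
apply: (boost (E `\` D)) => //.
by have := ler_normD (U (fun x => g x * \1_D x)) (U (fun x => g x * \1_(E `\` D) x)); rewrite -gU; lra.
Qed.

(* A functional bounded on a modular ball cannot survive the gain by
   [theta / 2 > 1] obtained at each halving. *)
Lemma clf_atomless f : LPhi mu Phi f -> U (fun x => f x * \1_E x) = 0.
Proof.
move=> Lf; have Lg := LPhi_restrict PhiP mE Lf.
set g := fun x => _ in Lg *.
have [C UC] := clf_bounded (fine (modular Phi mu g)).
rewrite fineK ?(modular_fin_num PhiP)// in UC.
(* Bernoulli's linear lower bound for [(theta / 2) ^+ n] suffices to exceed [C]; the induction drops
   a nonnegative multiple of [(theta / 2 - 1) ^+ 2]. *)
have iterate n : exists g', [/\ LPhi mu Phi g', forall x, ~ E x -> g' x = 0,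
    (modular Phi mu g' <= modular Phi mu g)%E &
    (1 + n%:R * (theta / 2 - 1)) * `|U g| <= `|U g'| ].
  elim: n => [|n [g1 [L1 z1 m1 U1]]].
    exists g; split => //; last by rewrite mul0r addr0 mul1r.
    by move=> x Ex; rewrite /g indicE memNset// mulr0.
  have [g2 [L2 z2 m2 U2]] := atomless_boost L1 z1.
  exists g2; split => //; first exact: le_trans m1.
  apply: le_trans U2; have t2 := cd_theta PhiP.
  apply: le_trans (_ : theta / 2 * ((1 + n%:R * (theta / 2 - 1)) * `|U g|) <= _); last first.
    by rewrite ler_wpM2l//; lra.
  rewrite mulrA ler_wpM2r// -natr1; have := mulr_ge0 (ler0n R n) (sqr_ge0 (theta / 2 - 1)).
  by rewrite expr2; lra.
apply/eqP; rewrite -normr_le0 leNgt; apply/negP => U0.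
have t2 := cd_theta PhiP.
have q0 : 0 < (theta / 2 - 1) * `|U g| by rewrite mulr_gt0//; lra.
have [g' [L' _ m' U']] := iterate (Num.truncn (C / ((theta / 2 - 1) * `|U g|))).+1.
have := UC _ L' m'; have := truncnS_gt (C / ((theta / 2 - 1) * `|U g|)).
rewrite ltr_pdivrMr//; move: U' U0; rewrite -/(U g); move: (_.+1%:R) (`|U g|) => N Ug.
nra.
Qed.

End atomless_part.

End continuous_functional.

(** * The almost everywhere constant value of a function on an atom *)

Section value_on_atom.
Context (R : realType) (d : measure_display) (T : measurableType d).
Context (mu : {measure set T -> \bar R}).
Hypothesis mu_fin : (mu setT < +oo)%E.
Context (A : set T).
Hypothesis atomA : atom mu A.
Implicit Types f g : T -> R.

Lemma atom_measurable : measurable A. Proof. by case: atomA. Qed.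

Lemma atom_not_negligible : ~ mu.-negligible A.
Proof.
by case: atomA => mA + _ => /[swap] /negligibleP-> //; rewrite ltxx.
Qed.

(** If [B] takes less than the full mass of [A], the definition of an atom applies; otherwise
    finiteness of [mu] allows cancelling that mass, and the remainder is null. *)
Lemma atom_dichotomy B : measurable B ->
  mu.-negligible (A `&` B) \/ mu.-negligible (A `&` ~` B).
Proof.
case: atomA => mA _ hA mB; have mAB := measurableI _ _ mA mB.
have mAC : measurable (A `&` ~` B) by apply: measurableI => //; exact: measurableC.
have fin C : measurable C -> mu C \is a fin_num.
  move=> mC; rewrite ge0_fin_numE//; apply: le_lt_trans mu_fin.
  by apply: le_measure; rewrite ?inE.
have split : mu A = (mu (A `&` B) + mu (A `&` ~` B))%E.
  rewrite -measureU//; first by rewrite -setIUr setUv setIT.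
  by apply/seteqP; split => // x [[_ Bx] [_ /(_ Bx)]].
have [lt|ge] := ltP (mu (A `&` B)) (mu A).
  by left; apply/negligibleP => //; apply: hA => //; exact: subIsetl.
right; apply/negligibleP => //; apply/eqP; rewrite -measure_le0.
by rewrite -(@leeD2lE _ (mu (A `&` B))) ?fin// -split adde0.
Qed.

(** By the dichotomy every level [t] leaves one side null in [A]. The constant is the supremum of
    the levels whose lower side is null, and the points with another value lie in countably many
    null sets. *)
Lemma atom_ae_constant f : measurable_fun setT f ->
  exists c, mu.-negligible (A `&` [set x | f x != c]).
Proof.
move=> mf.
have mle t : measurable [set x | f x <= t].
  rewrite -[X in measurable X]setTI; have := mf measurableT _ (measurable_itv `]-oo, t]).
  by congr measurable; apply/seteqP; split => x [_ /=]; rewrite in_itv/=.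
(* Applied to the levels [- n] and [n], this makes [S] nonempty and bounded above. *)
have cover (B : nat -> set T) : A `<=` \bigcup_n B n ->
    ~ (forall n, mu.-negligible (A `&` B n)).
  move=> AB Bn; apply: atom_not_negligible; apply: negligibleS (negligible_bigcup Bn).
  by move=> x Ax; have [n _ Bx] := AB x Ax; exists n.
pose S := [set t | mu.-negligible (A `&` [set x | f x <= t])].
have Sdown s t : S t -> s <= t -> S s.
  by move=> St st; apply: negligibleS St => x [Ax /= fs]; split => //=; exact: le_trans st.
have nS t : ~ S t -> mu.-negligible (A `&` [set x | t < f x]).
  move=> nSt; have [//|] := atom_dichotomy (mle t).
  by apply: negligibleS => x [Ax /= tf]; split => //; apply/negP; rewrite -ltNge.
have hS : has_sup S.
  split.
    apply: contrapT => S0; apply: (cover (fun n => [set x | - n%:R < f x])).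
      move=> x _; exists (Num.truncn (- f x)).+1 => //=.
      by rewrite ltrNl truncnS_gt.
    by move=> n; apply: nS => St; apply: S0; exists (- n%:R).
  apply: contrapT => S0; apply: (cover (fun n => [set x | f x <= n%:R])).
    by move=> x _; exists (Num.truncn (f x)).+1 => //=; exact/ltW/truncnS_gt.
  move=> n; apply: contrapT => nSn; apply: S0; exists n%:R => t St.
  by rewrite leNgt; apply/negP => /ltW nt; apply: nSn; exact: Sdown nt.
have e0 n : 0 < n.+1%:R^-1 :> R by rewrite invr_gt0.
exists (sup S).
have lo n : mu.-negligible (A `&` [set x | f x <= sup S - n.+1%:R^-1]).
  have [t St lt] := sup_adherent (e0 n) hS.
  by apply: (Sdown _ t) => //; exact: ltW.
have hi n : mu.-negligible (A `&` [set x | sup S + n.+1%:R^-1 < f x]).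
  apply: nS => Sn; have := ub_le_sup hS.2 Sn.
  by rewrite gerDl leNgt e0.
have close (e : R) : 0 < e -> exists n, n.+1%:R^-1 < e.
  move=> e_gt0; exists (Num.truncn e^-1).
  by rewrite invf_plt ?posrE// truncnS_gt.
apply: negligibleS (negligibleU (negligible_bigcup lo) (negligible_bigcup hi)).
move=> x [Ax /=]; rewrite neq_lt => /orP[fc|fc]; [left|right].
  have [|n hn] := close (sup S - f x); first by rewrite subr_gt0.
  by exists n => //; split => //; move: hn => /=; move: (_^-1) => e; lra.
have [|n hn] := close (f x - sup S); first by rewrite subr_gt0.
by exists n => //; split => //; move: hn => /=; move: (_^-1) => e; lra.
Qed.

Lemma aeval_ae f : measurable_fun setT f ->
  mu.-negligible (A `&` [set x | f x != aeval mu A f]).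
Proof.
move=> mf; have mN c : measurable (A `&` [set x | f x != c]).
  by apply: measurableI; [exact: atom_measurable|exact: measurable_neq_cst].
rewrite /aeval; case: xgetP => [c _ /= h|h]; first exact/negligibleP.
by have [c /(negligibleP mu (mN c))] := atom_ae_constant mf; move/h.
Qed.

(** For two different constants, every point of [A] would lie in one of two negligible sets. *)
Lemma aeval_unique f (c : R) : measurable_fun setT f ->
  mu.-negligible (A `&` [set x | f x != c]) -> aeval mu A f = c.
Proof.
move=> mf fc; apply: contrapT => /eqP nc; apply: atom_not_negligible.
apply: negligibleS (negligibleU (aeval_ae mf) fc) => x Ax.
have [E|?] := eqVneq (f x) c; [left|by right].
by split => //=; rewrite E eq_sym.
Qed.

Lemma aevalD f g : measurable_fun setT f -> measurable_fun setT g ->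
  aeval mu A (f \+ g) = aeval mu A f + aeval mu A g.
Proof.
move=> mf mg; apply: aeval_unique; first exact: measurable_funD.
apply: negligibleS (negligibleU (aeval_ae mf) (aeval_ae mg)) => x [Ax /= nE].
have [E|?] := eqVneq (f x) (aeval mu A f); [right|by left].
by split => //=; apply: contra nE => /eqP->; rewrite E.
Qed.

Lemma aevalZ (c : R) f : measurable_fun setT f ->
  aeval mu A (fun x => c * f x) = c * aeval mu A f.
Proof.
move=> mf; apply: aeval_unique; first exact: measurable_funM.
apply: negligibleS (aeval_ae mf) => x [Ax /= nE].
by split => //=; apply: contra nE => /eqP->.
Qed.

Lemma aeval_ae_eq f g : measurable_fun setT f -> measurable_fun setT g ->
  {ae mu, forall x, f x = g x} -> aeval mu A f = aeval mu A g.
Proof.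
move=> mf mg fg; apply: aeval_unique => //.
apply: negligibleS (negligibleU (aeval_ae mg) fg) => x [Ax /= nE].
have [E|?] := eqVneq (g x) (aeval mu A g); [right|by left].
by move=> /= fgx; move: nE; rewrite fgx E eqxx.
Qed.

Lemma restrict_atom_ae_eq f : measurable_fun setT f ->
  {ae mu, forall x, f x * \1_A x = aeval mu A f * \1_A x}.
Proof.
move=> mf; apply: negligibleS (aeval_ae mf) => x /= nE.
have [Ax|nAx] := pselect (A x).
  by split => //=; apply/eqP => E; apply: nE; rewrite E.
by case: nE; rewrite indicE memNset// !mulr0.
Qed.

End value_on_atom.

(** * Sums over the atoms, representation of functionals and their norm *)

Section family_of_atoms.
Context (R : realType) (Phi : R -> R) (theta : R).
Hypothesis PhiP : concave_doubling Phi theta.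
Context (d : measure_display) (T : measurableType d).
Context (mu : {measure set T -> \bar R}).
Hypothesis mu_fin : (mu setT < +oo)%E.
Context (J : set nat) (A : nat -> set T).
Hypothesis atomA : forall i, J i -> atom mu (A i).
Hypothesis disjA : forall i j, J i -> J j -> i <> j -> A i `&` A j = set0.
Implicit Types (f g : T -> R) (u : nat -> R).

Lemma LPhi_indic D : measurable D -> LPhi mu Phi \1_D.
Proof.
move=> mD; have L1 : LPhi mu Phi (cst 1).
  split => //; rewrite (eq_integral (cst (Phi 1)%:E))// integral_cst//.
  by rewrite lte_mul_pinfty// lee_fin (Phi_ge0 PhiP).
have := LPhi_restrict PhiP mD L1; congr LPhi.
by apply/funext => x /=; rewrite mul1r.
Qed.

Lemma atom_mass i : J i -> 0 < fine (mu (A i)) /\ mu (A i) = (fine (mu (A i)))%:E.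
Proof.
move=> /atomA [mA A0 _].
have fin : mu (A i) \is a fin_num.
  rewrite ge0_fin_numE//; apply: le_lt_trans mu_fin.
  by apply: le_measure; rewrite ?inE.
by rewrite fineK// fine_gt0// A0 -ge0_fin_numE.
Qed.

Lemma integral_Phi_atom i f : J i -> measurable_fun setT f ->
  (\int[mu]_(x in A i) (Phi (f x))%:E)%E =
  (Phi (aeval mu (A i) f) * fine (mu (A i)))%:E.
Proof.
move=> Ji mf; have mA := atom_measurable (atomA Ji).
rewrite EFinM -(atom_mass Ji).2 -integral_cst//; apply: ae_eq_integral => //.
  exact: (measurable_Phi_comp PhiP).
apply: negligibleS (aeval_ae mu_fin (atomA Ji) mf) => x /= nE.
apply: contrapT => nAE; apply: nE => Ax.
by apply: contrapT => fE; apply: nAE; split => //=; apply/eqP => E; apply: fE; rewrite E.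
Qed.

(** Restriction to [head n] matches the partial sum cut at index [n]; as [J] may have gaps, the step
    to [n.+1] adds either [A n] or nothing. *)
Let head n := \bigcup_(i in [set i | J i /\ (i < n)%N]) A i.
Let all_atoms := \bigcup_(i in J) A i.

Let measurable_head n : measurable (head n).
Proof. by apply: bigcup_measurable => i [Ji _]; exact: atom_measurable (atomA Ji). Qed.

Let measurable_all : measurable all_atoms.
Proof. by apply: bigcup_measurable => i Ji; exact: atom_measurable (atomA Ji). Qed.

Let head0 : head 0 = set0.
Proof. by apply/seteqP; split => // x [i []]. Qed.

Let headS_in n : J n -> head n.+1 = head n `|` A n.
Proof.
move=> Jn; apply/seteqP; split => x.
  move=> [i [Ji]]; rewrite ltnS leq_eqVlt => /predU1P[->|lt] Ax; first by right.
  by left; exists i.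
by move=> [[i [Ji lt] Ax]|Ax]; [exists i => //; split => //; exact: ltnW|exists n].
Qed.

Let headS_notin n : ~ J n -> head n.+1 = head n.
Proof.
move=> nJ; apply/seteqP; split => x [i [Ji lt] Ax]; exists i => //; split => //.
  by move: lt; rewrite ltnS leq_eqVlt => /predU1P[iE|//]; rewrite iE in Ji.
exact: ltnW.
Qed.

Let head_disj n : J n -> head n `&` A n = set0.
Proof.
move=> Jn; apply/seteqP; split => // x [[i [Ji lt] Aix] Anx].
have : (A i `&` A n) x by [].
by rewrite disjA// => iE; move: lt; rewrite iE ltnn.
Qed.

Let head_cvg : \bigcup_n head n = all_atoms.
Proof.
apply/seteqP; split => x; first by move=> [n _ [i [Ji _] Ax]]; exists i.
by move=> [i Ji Ax]; exists i.+1 => //; exists i.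
Qed.

Lemma sum_atomS (F : nat -> R) n : \sum_(0 <= i < n.+1 | i \in J) F i =
  \sum_(0 <= i < n | i \in J) F i + (if n \in J then F n else 0).
Proof. by rewrite big_mkcond/= big_nat_recr//= -big_mkcond. Qed.

Lemma integral_Phi_head f n : measurable_fun setT f ->
  (\int[mu]_(x in head n) (Phi (f x))%:E)%E =
  (\sum_(0 <= i < n | i \in J) Phi (aeval mu (A i) f) * fine (mu (A i)))%:E.
Proof.
move=> mf; elim: n => [|n IH]; first by rewrite head0 integral_set0 big_nil.
rewrite sum_atomS; case: ifPn => [/set_mem Jn|/negP nJ].
  rewrite headS_in// ge0_integral_setU//.
  - by rewrite IH integral_Phi_atom.
  - exact: atom_measurable (atomA Jn).
  - exact: (measurable_Phi_comp PhiP).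
  - by move=> x _; rewrite lee_fin (Phi_ge0 PhiP).
  - by apply/disj_setPS; rewrite head_disj.
by rewrite addr0 headS_notin// => Jn; apply: nJ; rewrite inE.
Qed.

(* Star-shapedness gives [|c| <= t * Phi_inv (1 / a)] for [t = Phi c * a <= 1],
   and these [t] add up to at most the modular of [f]. *)
Lemma atom_sum_modular_bound u (K : R) f n : 0 <= K ->
  (forall i, J i -> `|u i| * Phi_inv Phi (1 / fine (mu (A i))) <= K) ->
  LPhi mu Phi f -> (modular Phi mu f <= 1)%E ->
  \sum_(0 <= i < n | i \in J) `|u i * aeval mu (A i) f| <= K.
Proof.
move=> K0 uK [mf _] f1.
pose t i := Phi (aeval mu (A i) f) * fine (mu (A i)).
have t1 m : \sum_(0 <= i < m | i \in J) t i <= 1.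
  rewrite -lee_fin -integral_Phi_head//; apply: le_trans f1.
  apply: ge0_subset_integral => //; first exact: (measurable_Phi_comp PhiP).
  by move=> x _; rewrite lee_fin (Phi_ge0 PhiP).
have t0 i : J i -> 0 <= t i.
  by move=> Ji; rewrite mulr_ge0 ?(Phi_ge0 PhiP)// ltW// (atom_mass Ji).1.
apply: (@le_trans _ _ (\sum_(0 <= i < n | i \in J) K * t i)); last first.
  by rewrite -mulr_sumr ler_piMr.
apply: ler_sum => i /set_mem Ji.
have a0 := (atom_mass Ji).1; have ti0 := t0 i Ji.
have ti1 : t i <= 1.
  apply: le_trans (t1 i.+1); rewrite sum_atomS mem_set// lerDr.
  by apply: sumr_ge0 => j /set_mem; exact: t0.
have y0 : 0 < 1 / fine (mu (A i)) by rewrite divr_gt0.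
have P0 := Phi_inv_gt0 PhiP y0.
have cb : `|aeval mu (A i) f| <= t i * Phi_inv Phi (1 / fine (mu (A i))).
  apply: (Phi_le_inv PhiP); first by rewrite mulr_ge0// ltW.
  apply: le_trans (cd_star PhiP ti0 ti1 (ltW P0)).
  by rewrite (Phi_invK PhiP)// /t mul1r mulfK// gt_eqF.
rewrite normrM; apply: le_trans (ler_wpM2l (normr_ge0 (u i)) cb) _.
by rewrite mulrCA mulrC ler_wpM2r// uK.
Qed.

(** The strict inequality provides an admissible [l' < l] whether or not the infimum is attained;
    the modular bound is then applied to [f] divided by [l']. *)
Lemma atom_sum_norm_bound u (K l : R) f n : 0 <= K ->
  (forall i, J i -> `|u i| * Phi_inv Phi (1 / fine (mu (A i))) <= K) ->
  LPhi mu Phi f -> PhiNorm mu Phi f < l ->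
  \sum_(0 <= i < n | i \in J) `|u i * aeval mu (A i) f| <= K * l.
Proof.
move=> K0 uK Lf /(PhiNorm_lt_ex PhiP Lf)[l' [l'0 l'l hl']].
have := atom_sum_modular_bound n K0 uK (LPhiZ PhiP l'^-1 Lf) hl'.
have -> : \sum_(0 <= i < n | i \in J) `|u i * aeval mu (A i) (fun x => l'^-1 * f x)| =
    l'^-1 * \sum_(0 <= i < n | i \in J) `|u i * aeval mu (A i) f|.
  rewrite mulr_sumr; apply: eq_bigr => i /set_mem Ji.
  rewrite (aevalZ mu_fin (atomA Ji)); last by case: Lf.
  by rewrite mulrCA normrM gtr0_norm ?invr_gt0.
rewrite ler_pdivrMl// mulrC => /le_trans; apply.
by rewrite ler_wpM2l// ltW.
Qed.

Lemma norm_atom_psum_le u f n : `|atom_psum mu J A u f n| <=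
  \sum_(0 <= i < n | i \in J) `|u i * aeval mu (A i) f|.
Proof. exact: ler_norm_sum. Qed.

Lemma is_cvg_atom_psum u (K : R) f : 0 <= K ->
  (forall i, J i -> `|u i| * Phi_inv Phi (1 / fine (mu (A i))) <= K) ->
  LPhi mu Phi f -> cvgn (atom_psum mu J A u f).
Proof.
move=> K0 uK Lf.
pose v i : R := if i \in J then u i * aeval mu (A i) f else 0.
have -> : atom_psum mu J A u f = series v.
  by apply/funext => n; rewrite /atom_psum big_mkcond.
apply: normed_cvg; apply: nondecreasing_is_cvgn.
  by apply: nondecreasing_series => i _ _; exact: normr_ge0.
exists (K * (PhiNorm mu Phi f + 1)) => _ [n _ <-].
have lt : PhiNorm mu Phi f < PhiNorm mu Phi f + 1 by rewrite ltrDl.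
apply: le_trans (atom_sum_norm_bound n K0 uK Lf lt).
rewrite [leRHS]big_mkcond /series/=; apply: ler_sum => i _.
by rewrite /v; case: ifP; rewrite ?normr0.
Qed.

Lemma lim_atom_psum_le u (K l : R) f : 0 <= K ->
  (forall i, J i -> `|u i| * Phi_inv Phi (1 / fine (mu (A i))) <= K) ->
  LPhi mu Phi f -> PhiNorm mu Phi f < l ->
  `|limn (atom_psum mu J A u f)| <= K * l.
Proof.
move=> K0 uK Lf fl; have cv := is_cvg_atom_psum K0 uK Lf.
rewrite -lim_norm//; apply: limr_le; first exact: is_cvg_norm.
apply: nearW => n; apply: le_trans (norm_atom_psum_le _ _ _) _.
exact: atom_sum_norm_bound.
Qed.

Lemma atom_sum_is_clf u (K : R) : 0 <= K ->
  (forall i, J i -> `|u i| * Phi_inv Phi (1 / fine (mu (A i))) <= K) ->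
  is_clf mu Phi (fun f => limn (atom_psum mu J A u f)).
Proof.
move=> K0 uK; pose V f := limn (atom_psum mu J A u f).
have VD f g : LPhi mu Phi f -> LPhi mu Phi g -> V (f \+ g) = V f + V g.
  move=> Lf Lg; rewrite /V -limD; [|exact: is_cvg_atom_psum K0 uK Lf|exact: is_cvg_atom_psum K0 uK Lg].
  congr (limn _); apply/funext => n /=; rewrite /atom_psum /GRing.add/= -big_split/=.
  apply: eq_bigr => i /set_mem Ji; case: Lf Lg => mf _ [mg _].
  by rewrite (aevalD mu_fin (atomA Ji) mf mg) mulrDr.
have VZ (c : R) f : LPhi mu Phi f -> V (fun x => c * f x) = c * V f.
  move=> Lf; rewrite /V; have mf : measurable_fun setT f by case: Lf.
  rewrite (_ : atom_psum _ _ _ _ _ = fun n => c * atom_psum mu J A u f n).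
    apply: cvg_lim => //; apply: cvgM; first exact: cvg_cst.
    exact: is_cvg_atom_psum K0 uK Lf.
  apply/funext => n /=; rewrite /atom_psum mulr_sumr.
  apply: eq_bigr => i /set_mem Ji.
  by rewrite (aevalZ mu_fin (atomA Ji) c mf) mulrCA.
split => // [f g [mf _] [mg _] fg|f Lf e e0].
  congr (limn _); apply/funext => n; apply: eq_bigr => i /set_mem Ji.
  by rewrite (aeval_ae_eq mu_fin (atomA Ji) mf mg fg).
(* The denominator [K + 1] covers [K = 0] and keeps [K] times this radius strictly below [e]. *)
exists (e / (K + 1)); first by rewrite divr_gt0//; lra.
move=> g Lg /(lim_atom_psum_le K0 uK (LPhiB PhiP Lg Lf)).
have -> : V g - V f = V (g \- f).
  rewrite -mulN1r -VZ// -VD//; last exact: (LPhiZ PhiP).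
  by congr V; apply/funext => x /=; rewrite mulN1r.
move=> /le_lt_trans; apply; rewrite mulrA ltr_pdivrMr; last lra.
by rewrite mulrC ltr_pM2l//; lra.
Qed.

Section functional.
Context (U : (T -> R) -> R).
Hypothesis UP : is_clf mu Phi U.

(** On one atom [f] is almost everywhere a constant multiple of the indicator, so invariance of [U]
    under a.e. equality and homogeneity give each term; additivity over disjoint atoms does the
    rest. *)
Lemma clf_head f n : LPhi mu Phi f ->
  U (fun x => f x * \1_(head n) x) = atom_psum mu J A (fun i => U \1_(A i)) f n.
Proof.
move=> Lf; have [mf _] := Lf; rewrite /atom_psum.
elim: n => [|n IH].
  rewrite big_nil -(clf0 PhiP UP); congr U; apply/funext => x.
  by rewrite head0 indic0 mulr0.
rewrite sum_atomS; case: ifPn => [/set_mem Jn|/negP nJ]; last first.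
  by rewrite addr0 -IH headS_notin// => Jn; apply: nJ; rewrite inE.
have mA := atom_measurable (atomA Jn).
have LA : LPhi mu Phi \1_(A n) by exact: LPhi_indic.
have Lr D (mD : measurable D) := LPhi_restrict PhiP mD Lf.
have <- : U (fun x => f x * \1_(A n) x) = U \1_(A n) * aeval mu (A n) f.
  rewrite mulrC -(clfZ UP)//; case: UP => _ _ Uae _; apply: Uae => //.
  - exact: Lr.
  - exact: (LPhiZ PhiP).
  - exact: (restrict_atom_ae_eq mu_fin (atomA Jn)).
rewrite -IH -(clfD UP); [|exact: Lr|exact: Lr].
congr U; apply/funext => x /=; rewrite -mulrDr headS_in//; congr (_ * _).
have := head_disj Jn; rewrite !indicE in_setU.
have [/set_mem h|//] := boolP (x \in head n); have [/set_mem h'|//] := boolP (x \in A n).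
- by move=> E; have : (head n `&` A n) x by []; rewrite E.
- by rewrite addr0.
- by rewrite add0r.
- by rewrite addr0.
Qed.

Hypothesis rest_atomless : forall B, B `<=` ~` all_atoms -> ~ atom mu B.

Lemma clf_atom_sum f : LPhi mu Phi f ->
  atom_psum mu J A (fun i => U \1_(A i)) f @ \oo --> U f.
Proof.
move=> Lf; have [mf _] := Lf.
have Lr D (mD : measurable D) := LPhi_restrict PhiP mD Lf.
have mPhi D : measurable_fun D (fun x => (Phi (f x))%:E).
  exact: (measurable_Phi_comp PhiP).
have Pf0 x : (0 <= (Phi (f x))%:E)%E by rewrite lee_fin (Phi_ge0 PhiP).
have mtail n := measurableD measurable_all (measurable_head n).
have head_all n : head n `<=` all_atoms by move=> x [i [Ji _] Ax]; exists i.
have Usplit n : U f - atom_psum mu J A (fun i => U \1_(A i)) f n =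
    U (fun x => f x * \1_(all_atoms `\` head n) x).
  rewrite -clf_head//; apply/eqP; rewrite subr_eq; apply/eqP.
  rewrite -(clfD UP); [|exact: Lr|exact: Lr].
  have Z := clf_atomless PhiP UP (measurableC measurable_all) rest_atomless Lf.
  rewrite -[RHS]addr0 -Z -(clfD UP); [|apply: (LPhiD PhiP); exact: Lr|by apply: Lr; exact: measurableC].
  congr U; apply/funext => x /=; rewrite -!mulrDr !indicE in_setD in_setC.
  have [xh|xh] := boolP (x \in head n).
    by rewrite (mem_set (head_all n _ (set_mem xh))) add0r addr0 mulr1.
  by case: (x \in all_atoms); rewrite ?addr0 ?add0r mulr1.
have fin D : measurable D -> (\int[mu]_(x in D) (Phi (f x))%:E)%E \is a fin_num.
  by move=> mD; rewrite -(modular_restrict PhiP mu f mD) (modular_fin_num PhiP)//; exact: Lr.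
(* Monotone convergence on increasing domains; since the limit is finite, the modular of the tail is
   a difference tending to 0. *)
have cvI : (\int[mu]_(x in head n) (Phi (f x))%:E)%E @[n --> \oo] -->
    (\int[mu]_(x in all_atoms) (Phi (f x))%:E)%E.
  rewrite -head_cvg; apply: ge0_nondecreasing_set_cvg_integral => //.
  apply/nondecreasing_seqP => n; apply/subsetPset => x [i [Ji lt] Ax].
  by exists i => //; split => //; exact: ltnW.
apply/cvgrPdist_lt => e e0.
have [del del0 Udel] := clf_small PhiP UP e0.
move: cvI; rewrite -(fineK (fin _ measurable_all)) => /fine_cvg/cvgrPdist_lt/(_ del del0).
apply: filterS => n hn; rewrite Usplit; apply: Udel; first exact: Lr.
rewrite (modular_restrict PhiP)// -[leLHS]fineK ?fin// lee_fin.
have E : (\int[mu]_(x in all_atoms) (Phi (f x))%:E)%E =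
  (\int[mu]_(x in head n) (Phi (f x))%:E + \int[mu]_(x in all_atoms `\` head n) (Phi (f x))%:E)%E.
  rewrite -[in LHS](setDUK (head_all n)) ge0_integral_setU//.
  by apply/disj_setPS => x [hx []].
move: hn; rewrite E fineD ?fin// addrAC subrr add0r => hn.
exact: ltW (le_lt_trans (ler_norm _) hn).
Qed.

Hypothesis J_nonempty : J !=set0.

(** Each term is attained by the indicator of [A i] scaled by [Phi_inv Phi (1 / a)], with [a] the
    mass of [A i], whose modular is exactly 1. Conversely [PhiNorm <= 1] gives the bound [r * l] for
    all [l > 1], hence [r]. *)
Lemma opnorm_atoms : opnorm mu Phi U =
  ereal_sup [set (`|U \1_(A i)| * Phi_inv Phi (1 / fine (mu (A i))))%:E | i in J].
Proof.
have Pi0 i : J i -> 0 < Phi_inv Phi (1 / fine (mu (A i))).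
  by move=> Ji; apply: (Phi_inv_gt0 PhiP); rewrite divr_gt0// (atom_mass Ji).1.
set S := ereal_sup _; apply/eqP; rewrite eq_le; apply/andP; split; last first.
  apply: ge_ereal_sup => _ [i Ji <-]; apply: ereal_sup_ubound.
  have mA := atom_measurable (atomA Ji); have LA := LPhi_indic mA.
  set c := Phi_inv _ _; have c0 : 0 < c by exact: Pi0.
  exists (fun x => c * \1_(A i) x); last first.
    by rewrite (clfZ UP)// normrM gtr0_norm// mulrC.
  split; first exact: (LPhiZ PhiP).
  rewrite -[leRHS]invr1 -(expr0 theta); apply: (PhiNorm_le_modular PhiP).
    exact: (LPhiZ PhiP).
  rewrite (modular_restrict PhiP mu (cst c))//= integral_cst// expr0 invr1.
  rewrite /c (Phi_invK PhiP) ?divr_gt0 ?(atom_mass Ji).1//.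
  by rewrite (atom_mass Ji).2 -EFinM/= divfK// gt_eqF// (atom_mass Ji).1.
(* An index in [J] is essential here, as the supremum of the empty set is [-oo]. *)
have S0 : (0 <= S)%E.
  have [i Ji] := J_nonempty; apply: le_trans (ereal_sup_ubound _); last by exists i.
  by rewrite lee_fin mulr_ge0// ltW// Pi0.
apply: ge_ereal_sup => _ [f [Lf f1] <-].
have ub i : J i -> ((`|U \1_(A i)| * Phi_inv Phi (1 / fine (mu (A i))))%:E <= S)%E.
  by move=> Ji; apply: ereal_sup_ubound; exists i.
move: S S0 ub => [r r0 ub|_ _|//]; last exact: leey.
have scaled l : 1 < l -> `|U f| <= r * l.
  move=> l1; rewrite -(cvg_lim _ (clf_atom_sum Lf))//.
  by apply: lim_atom_psum_le => //; exact: le_lt_trans l1.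
rewrite lee_fin in r0 *; rewrite leNgt; apply/negP => lt.
have r1 : 0 < r + 1 by rewrite ltr_wpDl.
(* For [l] equal to 1 plus this quotient, [r * l] falls below the norm of [U f] by exactly the
   quotient; dividing by [r + 1] also covers [r = 0]. *)
have e0 : 0 < (`|U f| - r) / (r + 1) by rewrite divr_gt0// subr_gt0.
have := scaled (1 + (`|U f| - r) / (r + 1)); rewrite ltrDl => /(_ e0).
have : (`|U f| - r) / (r + 1) * (r + 1) = `|U f| - r by rewrite divfK// gt_eqF.
by lra.
Qed.

End functional.

End family_of_atoms.

Theorem theorem4p2 (R : realType) (d : measure_display) (T : measurableType d)
    (mu : {measure set T -> \bar R}) (Phi : R -> R) :
  (mu setT < +oo)%E ->
  NstarFun Phi ->
  (exists k : R, 2 <= k /\ forall x : R, 0 < x -> Phi (k * x) = 2 * Phi x) ->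
  (* no atoms *)
  ((~ exists B, atom mu B) ->
     forall U, is_clf mu Phi U -> forall f, LPhi mu Phi f -> U f = 0)
  /\
  (* atoms exist *)
  (forall (J : set nat) (A : nat -> set T),
     (exists B, atom mu B) ->
     (forall i, J i -> atom mu (A i)) ->
     (forall i j, J i -> J j -> i <> j -> A i `&` A j = set0) ->
     (forall B, atom mu B -> exists! i, J i /\ mu (symdiff B (A i)) = 0%E) ->
     (forall U, is_clf mu Phi U ->
        (forall f, LPhi mu Phi f ->
           atom_psum mu J A (fun i => U (\1_(A i))) f @ \oo --> U f)
        /\ opnorm mu Phi U =
           ereal_sup [set (`|U (\1_(A i))| * Phi_inv Phi (1 / fine (mu (A i))))%:E
                     | i in J])
     /\
     (forall (u : nat -> R) (K : R),
        (forall i, J i -> `|u i| <= K / Phi_inv Phi (1 / fine (mu (A i)))) ->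
        (forall f, LPhi mu Phi f -> cvgn (atom_psum mu J A u f))
        /\ is_clf mu Phi (fun f => limn (atom_psum mu J A u f)))).
Proof.
move=> mu_fin NPhi [k [k2 Phik]].
have PhiP := NstarFun_concave_doubling NPhi k2 Phik.
split=> [noatom U UP f Lf|J A [B0 atomB0] atomA disjA reprA].
  have := clf_atomless PhiP UP measurableT (fun B _ aB => noatom (ex_intro _ B aB)) Lf.
  by apply: etrans; congr U; apply/funext => x /=; rewrite indicT mulr1.
have [i0 [[Ji0 _] _]] := reprA B0 atomB0.
(* An atom off the family would be disjoint from its own representative, hence contained in a null
   symmetric difference. *)
have rest B : B `<=` ~` (\bigcup_(i in J) A i) -> ~ atom mu B.
  move=> BA aB; have [i [[Ji muS] _]] := reprA B aB.
  have [mB B_gt0 _] := aB; have [mA _ _] := atomA i Ji.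
  have sub : B `<=` symdiff B (A i).
    by move=> x Bx; left; split => // Ax; apply: (BA x Bx); exists i.
  have msym : measurable (symdiff B (A i)) by apply: measurableU; exact: measurableD.
  have : (mu B <= mu (symdiff B (A i)))%E by apply: le_measure; rewrite ?inE.
  by rewrite muS leNgt B_gt0.
split=> [U UP|u K uK].
  split; first by move=> f Lf; exact: (clf_atom_sum PhiP mu_fin atomA disjA UP rest).
  by apply: (opnorm_atoms PhiP mu_fin atomA disjA UP rest); exists i0.
have Pi0 i : J i -> 0 < Phi_inv Phi (1 / fine (mu (A i))).
  move=> Ji; apply: (Phi_inv_gt0 PhiP).
  by rewrite divr_gt0// (atom_mass mu_fin atomA Ji).1.
have {}uK i : J i -> `|u i| * Phi_inv Phi (1 / fine (mu (A i))) <= K.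
  by move=> Ji; rewrite -ler_pdivlMr ?Pi0// uK.
(* The sign of [K] is forced by the bound at the index [i0], which exists because there is an
   atom. *)
have K0 : 0 <= K by apply: le_trans (uK _ Ji0); rewrite mulr_ge0// ltW// Pi0.
split; last exact: (atom_sum_is_clf PhiP mu_fin atomA disjA K0 uK).
by move=> f Lf; exact: (is_cvg_atom_psum PhiP mu_fin atomA disjA K0 uK).
Qed.
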